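(* Let $d=2$ or $d=3$ and let $A\in PL_d$. Then every eigenvalue of $A$ is either $0$ or a root of unity.
   Context: Matrices have entries in a field $k$ of characteristic $0$. A $d\times d$ matrix is a Permutation-Like Matrix (PLM) if all its entries are $0$ or $1$ and each column contains exactly one entry equal to $1$; $PL_d$ is the set of all $d\times d$ PLM. *)

(* Defs.v *)
From HB Require Import structures.
From mathcomp Require Import all_boot all_order all_algebra.

Set Implicit Arguments.
Unset Strict Implicit.
Unset Printing Implicit Defensive.

Import GRing.Theory.
Local Open Scope ring_scope.

Definition PL (k : fieldType) (d : nat) : {pred 'M[k]_d} :=
  [pred A : 'M[k]_d |
     [forall i, forall j, (A i j == 0) || (A i j == 1)]
     && [forall j, #|[set i | A i j == 1]| == 1%N]].
Arguments PL k d : clear implicits.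

(* The bound [0 < n] is needed: [0.-unity_root x] holds for every [x]. *)
Definition is_root_of_unity (L : fieldType) (x : L) : Prop :=
  exists2 n : nat, (0 < n)%N & n.-unity_root x.

(* Main.v *)
(* A row eigenvector v of A satisfies v_(f j) = lambda * v_j, where f j is the
   row of the 1 in column j. Iterating, v_(f^n j) = lambda^n * v_j; the orbit of
   an index j with v_j != 0 is finite, so two distinct powers of lambda agree. *)
Require Import Defs.
From HB Require Import structures.
From mathcomp Require Import all_boot all_order all_algebra.

Set Implicit Arguments.
Unset Strict Implicit.
Unset Printing Implicit Defensive.

Import GRing.Theory.
Local Open Scope ring_scope.

(** Recasts the column condition as a self-map of the indices, which can be iterated. *)
Lemma PL_fun (k : fieldType) (d : nat) (A : 'M[k]_d) :
  A \in PL k d -> exists f : 'I_d -> 'I_d, forall i j, A i j = (i == f j)%:R.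
Proof.
case/andP=> /forallP A01 /forallP A1.
suff /fin_all_exists[f Hf] : forall j, exists i, forall i', A i' j = (i' == i)%:R.
  by exists f => i j; apply: Hf.
move=> j; have /cards1P[i Ei] := A1 j; exists i => i'.
have : (A i' j == 1) = (i' == i) by rewrite -in_set1 -Ei inE.
by case: (i' == i) => [/eqP //|A'1]; have /forallP/(_ j) := A01 i'; rewrite A'1 orbF => /eqP.
Qed.

(** Pigeonhole: the first [#|T|.+1] iterates cannot be pairwise distinct. *)
Lemma iter_collision (T : finType) (f : T -> T) (x : T) :
  exists m n : nat, (m < n)%N /\ iter m f x = iter n f x.
Proof.
pose g (n : 'I_#|T|.+1) := iter n f x.
have /injectivePn[m [n neq_mn eq_g]] : ~~ injectiveb g.
  by apply/negP => /injectiveP/leq_card; rewrite card_ord ltnn.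
case: (ltngtP m n) => [lt_mn|lt_nm|/val_inj eq_mn].
- by exists m, n.
- by exists n, m.
- by rewrite eq_mn eqxx in neq_mn.
Qed.

(** If [x != 0], cancelling [x ^+ m] leaves [x ^+ (n - m) = 1]. *)
Lemma eq_exp_root_of_unity (L : fieldType) (x : L) (m n : nat) :
  (m < n)%N -> x ^+ m = x ^+ n -> x = 0 \/ is_root_of_unity x.
Proof.
move=> lt_mn; have [->|x_neq0] := eqVneq x 0; first by left.
rewrite -(subnKC (ltnW lt_mn)) exprD -{1}[x ^+ m]mulr1.
move/(mulfI (expf_neq0 m x_neq0)) => xn1; right.
by exists (n - m)%N; [rewrite subn_gt0 | apply/unity_rootP].
Qed.

(* The eigenvalues of [A] are taken in an arbitrary extension field
   [iota : k -> L], since the characteristic polynomial of [A] need not split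
   over [k]; [L = k] and [L] an algebraic closure of [k] are instances.
   [eigenvalue] refers to row eigenvectors; for a square matrix these have the
   same eigenvalues as column eigenvectors. *)
Theorem corollary4p5 (k : fieldType) (char_k : [pchar k] =i pred0)
    (d : nat) (hd : d = 2%N \/ d = 3%N) (A : 'M[k]_d) (hA : A \in PL k d)
    (L : fieldType) (iota : {rmorphism k -> L}) (lambda : L) :
  eigenvalue (map_mx iota A) lambda ->
  lambda = 0 \/ is_root_of_unity lambda.
Proof.
have [f Af] := PL_fun hA.
case/eigenvalueP=> v v_eig /rV0Pn[j vj_neq0].
have v_f i : v 0 (f i) = lambda * v 0 i.
  have := congr1 (fun w : 'rV_d => w 0 i) v_eig; rewrite !mxE => <-.
  (* In entry [i] of the product, only row [f i] of column [i] contributes. *)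
  rewrite (bigD1 (f i)) //= big1 => [|l /negPf l_neq].
    by rewrite mxE Af eqxx rmorph1 mulr1 addr0.
  by rewrite mxE Af l_neq rmorph0 mulr0.
have v_iter n : v 0 (iter n f j) = lambda ^+ n * v 0 j.
  by elim: n => [|n IHn]; rewrite ?mul1r // iterS v_f IHn exprS mulrA.
have [m [n [lt_mn eq_iter]]] := iter_collision f j.
apply: (eq_exp_root_of_unity lt_mn); apply: (mulIf vj_neq0).
by rewrite -!v_iter eq_iter.
Qed.
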